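(* Let $B$ be a symmetric matrix over a field of characteristic $2$, with $\operatorname{epr}(B)=\ell_1\ell_2\cdots\ell_n$. If $\ell_k\ell_{k+1}=\mathtt{NA}$ or $\ell_k\ell_{k+1}=\mathtt{NS}$ for some $k$, then $k$ is odd and $\ell_j=\mathtt{N}$ for every odd $j$ (with $1\le j\le n$).
   Context: For an $n\times n$ symmetric matrix $B$ over a field $\mathbb{F}$, the enhanced principal rank characteristic sequence (epr-sequence) is $\operatorname{epr}(B)=\ell_1\ell_2\cdots\ell_n$, where $\ell_k=\mathtt{A}$ if all principal minors of $B$ of order $k$ are nonzero, $\ell_k=\mathtt{S}$ if some but not all principal minors of order $k$ are nonzero, and $\ell_k=\mathtt{N}$ if all principal minors of order $k$ are zero. *)

(* Defs.v *)
From HB Require Import structures.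
From mathcomp Require Import all_boot all_order all_algebra.
Set Implicit Arguments.
Unset Strict Implicit.
Unset Printing Implicit Defensive.
Import GRing.Theory.
Local Open Scope ring_scope.

Inductive epr_symbol : Type := eprA | eprS | eprN.

(* [enum_val] lists the elements of [I] in increasing order, so this is the
   determinant of the submatrix of B on the rows and columns indexed by I. *)
Definition principal_minor (F : fieldType) (n : nat) (B : 'M[F]_n)
    (I : {set 'I_n}) : F :=
  \det (\matrix_(i < #|I|, j < #|I|) B (enum_val i) (enum_val j)).

(* The three cases are exclusive for k <= n; for k > n, where there are no
   minors of order k, the value is the vacuous eprA, which [epr] never uses. *)
Definition epr_entry (F : fieldType) (n : nat) (B : 'M[F]_n) (k : nat) :
    epr_symbol :=
  if [forall (I : {set 'I_n} | #|I| == k), principal_minor B I != 0] then eprA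
  else if [exists (I : {set 'I_n} | #|I| == k), principal_minor B I != 0]
  then eprS
  else eprN.

(* The item of index i, counted from 0, is the (i+1)-st term of the sequence. *)
Definition epr (F : fieldType) (n : nat) (B : 'M[F]_n) : n.-tuple epr_symbol :=
  [tuple epr_entry B i.+1 | i < n].

(* The k-th term of a sequence numbered from 1; the default value is returned
   only when k is larger than the length. *)
Definition epr_term (l : seq epr_symbol) (k : nat) : epr_symbol :=
  nth eprN l k.-1.

(* Main.v *)
Require Import Defs.
From HB Require Import structures.
From mathcomp Require Import all_boot all_order all_algebra.
From mathcomp Require Import fingroup perm.
Set Implicit Arguments.
Unset Strict Implicit.
Unset Printing Implicit Defensive.
Import GRing.Theory.
Local Open Scope ring_scope.

(** In characteristic 2 a sum invariant under an involution reduces to its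
    fixed points.  Hence a symmetric matrix with zero diagonal (an alternating
    matrix) has determinant 0 in odd order, and congruence preserves
    alternation.

    Let C be an invertible principal submatrix of order k+1.  As all its
    principal minors of order k vanish, its adjugate is alternating, and so is
    C = C (adj C) C / det C; in particular k+1 is even.  Suppose that b = B j j
    is nonzero, so that j is not an index of C.  Add b to one diagonal entry q
    of C.  Since the principal submatrices of odd order k of C have
    determinant 0, the determinant of C does not change, and a principal minor
    of order k containing q becomes b times a principal minor of C of order
    k-1; it is also the minor of B obtained by replacing the index q with j,
    so it vanishes.  By the first part, the modified C is alternating, although
    its (q, q) entry is b. *)

Section Char2.

Variables (R : comNzRingType) (hchar : 2%N \in [pchar R]).

Lemma sum_involution_pchar2 (T : finType) (g : T -> T) (h : T -> R) :
    involutive g -> (forall x, h (g x) = h x) ->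
  \sum_x h x = \sum_(x | g x == x) h x.
Proof.
move=> gK hg; rewrite (bigID (fun x => g x == x)) /= -[RHS]addr0; congr (_ + _).
(* A total order selects one point of each two-element orbit; [g] exchanges the two halves, whose
   equal sums cancel in characteristic 2. *)
pose lt (x y : T) := (enum_rank x < enum_rank y)%N.
have ltNg x : g x != x -> lt (g x) x = ~~ lt x (g x).
  move=> gx; rewrite /lt -leqNgt ltn_neqAle.
  by rewrite (inj_eq val_inj) (inj_eq enum_rank_inj) gx.
rewrite (bigID (fun x => lt x (g x))) /=.
rewrite [X in _ + X](reindex_inj (inv_inj gK)) /=.
under [X in _ + X]eq_bigr do rewrite hg.
under [X in _ + X]eq_bigl => x.
  rewrite gK eq_sym; have -> : (g x != x) && ~~ lt (g x) x
      = (g x != x) && lt x (g x).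
    by case: (boolP (g x == x)) => //= /ltNg ->; rewrite negbK.
over.
by rewrite (addrr_pchar2 hchar).
Qed.

(** Without fixed points, the sum of 1 over ['I_n] would vanish, so [n] would be even. *)
Lemma involution_fixpoint_odd n (g : 'I_n -> 'I_n) :
  involutive g -> odd n -> exists i, g i = i.
Proof.
move=> gK on; case: (pickP (fun i => g i == i)) => [i /eqP gi|g0]; first by exists i.
have := @sum_involution_pchar2 'I_n g (fun=> 1) gK (fun=> erefl).
rewrite [RHS]big_pred0 // sumr_const card_ord => /eqP.
by rewrite -(dvdn_pcharf hchar) dvdn2 on.
Qed.

(** Inversion of permutations pairs the Leibniz terms. A self-inverse permutation of an odd number
    of points fixes one of them, which puts a zero diagonal entry in its term. *)
Lemma det_alternating_odd n (A : 'M[R]_n) :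
  A^T = A -> (forall i, A i i = 0) -> odd n -> \det A = 0.
Proof.
move=> At A0 on; rewrite /determinant.
rewrite (@sum_involution_pchar2 _ (fun s : {perm 'I_n} => s^-1%g)) => [||s] /=.
- apply: big1 => s /eqP sV.
  have sK : involutive s by move=> i; rewrite -{1}sV permK.
  have [i si] := involution_fixpoint_odd sK on.
  by rewrite (bigD1 i) //= si A0 mul0r mulr0.
- exact: invgK.
- rewrite odd_permV (reindex_inj (@perm_inj _ s)) /=; congr (_ * _).
  by apply: eq_bigr => i _; rewrite permK -[in LHS]At mxE.
Qed.

(** Swapping the two summation indices pairs the terms of the double sum; the unpaired ones contain
    a diagonal entry of [A]. *)
Lemma congr_alternating n m (A : 'M[R]_n) (X : 'M[R]_(n, m)) :
    A^T = A -> (forall i, A i i = 0) ->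
  forall i, (X^T *m A *m X) i i = 0.
Proof.
move=> At A0 i; rewrite mxE.
under eq_bigr do rewrite mxE mulr_suml.
rewrite pair_bigA /= (@sum_involution_pchar2 _ (fun p => (p.2, p.1))) => [||p] /=.
- by apply: big1 => -[a c] /= /eqP[->]; rewrite A0 mulr0 mul0r.
- by case.
- by rewrite -[in LHS]At !mxE mulrC mulrA mulrAC.
Qed.

Lemma det_add_diag n (A : 'M[R]_n) (q : 'I_n) (b : R) :
  \det (A + b *: delta_mx q q) = \det A + b * \det (row' q (col' q A)).
Proof.
have cofE j : cofactor (A + b *: delta_mx q q) q j = cofactor A q j.
  congr (_ * \det _); apply/matrixP => x y; rewrite !mxE.
  by rewrite eq_sym (negPf (neq_lift _ _)) mulr0 addr0.
rewrite !(expand_det_row _ q) (bigD1 q) //= [in RHS](bigD1 q) //=.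
rewrite !mxE !eqxx mulr1 mulrDl !cofE -!addrA; congr (_ + _).
rewrite addrC; congr (_ + _).
  by apply: eq_bigr => j jq; rewrite cofE !mxE (negPf jq) andbF mulr0 addr0.
by rewrite /cofactor -signr_odd oddD addbb mul1r.
Qed.

(** Adding [A q q] at position [(q, q)] clears the diagonal, so the determinant becomes zero. *)
Lemma det_diag1_odd n (A : 'M[R]_n) (q : 'I_n) :
    A^T = A -> (forall i, i != q -> A i i = 0) -> odd n ->
  \det A = A q q * \det (row' q (col' q A)).
Proof.
move=> At A0 on.
suff /eqP: \det (A + A q q *: delta_mx q q) = 0.
  by rewrite det_add_diag addr_eq0 (oppr_pchar2 hchar) => /eqP.
apply: det_alternating_odd => // [|i].
  by rewrite linearD linearZ /= At trmx_delta.
rewrite !mxE andbb; have [->|iq] := eqVneq i q.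
  by rewrite mulr1 (addrr_pchar2 hchar).
by rewrite (A0 i) // mulr0 addr0.
Qed.

End Char2.

Section Char2Field.

Variables (F : fieldType) (hchar : 2%N \in [pchar F]).

Lemma alternating_of_minors n (C : 'M[F]_n) :
    C^T = C -> \det C != 0 ->
    (forall p, \det (row' p (col' p C)) = 0) ->
  forall i, C i i = 0.
Proof.
move=> Ct dC C0 i.
have : (C^T *m \adj C *m C) i i = 0.
  apply: congr_alternating => // [|j]; first by rewrite trmx_adj Ct.
  by rewrite mxE /cofactor C0 mulr0.
rewrite Ct mul_mx_adj mul_scalar_mx mxE => /eqP.
by rewrite mulf_eq0 (negPf dC) => /eqP.
Qed.

(** Unlike [enum_val], [f] need not be increasing; reordering applies one permutation to both rows
    and columns, so its sign cancels. *)
Lemma det_mxsub_principal n m (B : 'M[F]_n) (f : 'I_m -> 'I_n) :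
  injective f -> \det (mxsub f f B) = principal_minor B (f @: 'I_m).
Proof.
move=> fI; rewrite /principal_minor; set I := f @: 'I_m.
have cI : #|I| = m by rewrite card_imset ?card_ord.
have fin i : f i \in I by apply: imset_f.
pose h i := cast_ord cI (enum_rank_in (fin i) (f i)).
have hE i : enum_val (cast_ord (esym cI) (h i)) = f i.
  by rewrite cast_ordK enum_rankK_in.
have hI : injective h by move=> i j hij; apply: fI; rewrite -!hE hij.
pose M := mxsub (fun i => enum_val (cast_ord (esym cI) i))
                (fun i => enum_val (cast_ord (esym cI) i)) B.
have -> : mxsub f f B = row_perm (perm hI) (col_perm (perm hI) M).
  by apply/matrixP => i j; rewrite !mxE !permE !hE.
rewrite row_permE col_permE !det_mulmx !det_perm mulrC -mulrA odd_permV.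
rewrite -signr_addb addbb mulr1 /M.
clear; move: (cI); rewrite -cI => e.
by congr (\det _); apply/matrixP => i j; rewrite !mxE !cast_ord_id.
Qed.

Variables (n k : nat) (B : 'M[F]_n).
Hypotheses (Bt : B^T = B)
  (minors0 : forall f : 'I_k -> 'I_n, injective f -> \det (mxsub f f B) = 0).

Variable f : 'I_k.+1 -> 'I_n.
Hypotheses (fI : injective f) (df : \det (mxsub f f B) != 0).

Lemma mxsub_sym m (g : 'I_m -> 'I_n) : (mxsub g g B)^T = mxsub g g B.
Proof. by rewrite trmx_mxsub Bt. Qed.

Lemma nonsingular_alternating i : B (f i) (f i) = 0.
Proof.
suff: mxsub f f B i i = 0 by rewrite mxE.
apply: alternating_of_minors => // [|p]; first exact: mxsub_sym.
rewrite row'Esub col'Esub -mxsubrc -mxsub_comp minors0 //.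
exact: (inj_comp fI (@lift_inj _ p)).
Qed.

Lemma nonsingular_order_even : odd k.
Proof.
apply: contraNT df => ok; apply/eqP/(det_alternating_odd hchar) => // [|i].
  exact: mxsub_sym.
by rewrite mxE nonsingular_alternating.
Qed.

Lemma alternating_of_nonsingular j : B j j = 0.
Proof.
apply/eqP/negPn/negP => bj0; have ok := nonsingular_order_even.
have jf i : f i != j.
  by apply: contraNneq bj0 => <-; rewrite nonsingular_alternating.
pose q : 'I_k.+1 := ord0; pose C := mxsub f f B.
have minorC p : \det (row' p (col' p C)) = 0.
  rewrite row'Esub col'Esub -mxsubrc -mxsub_comp minors0 //.
  exact: (inj_comp fI (@lift_inj _ p)).
pose C1 := C + B j j *: delta_mx q q.
have C1t : C1^T = C1 by rewrite linearD linearZ /= mxsub_sym trmx_delta.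
suff: C1 q q = 0.
  by apply/eqP; rewrite !mxE nonsingular_alternating add0r !eqxx mulr1.
apply: alternating_of_minors => // [|p].
  by rewrite det_add_diag minorC mulr0 addr0.
have [{p}->|pq] := eqVneq p q.
  rewrite -[RHS](minorC q); congr (\det _); apply/matrixP => x y.
  by rewrite !mxE eq_sym (negPf (neq_lift _ _)) mulr0 addr0.
(* [q'] is the position of [q] after index [p] is deleted. *)
have [q' q'E|] := unliftP p q; last by move=> qp; rewrite qp eqxx in pq.
pose g i := if i == q then j else f i.
have gI : injective g.
  move=> x y; rewrite /g; case: eqP => [->|_]; case: eqP => [->|_] //.
  - by move=> e; case/eqP: (jf y).
  - by move=> e; case/eqP: (jf x).
  - exact: fI.
have gpI : injective (g \o lift p) := inj_comp gI (@lift_inj _ p).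
have liftq x : (lift p x == q) = (x == q') by rewrite q'E (inj_eq lift_inj).
(* The submatrices of [C1] and of [B] along [g] have odd order [k], carry [B j j] at [q'] and zeros
   elsewhere on the diagonal, and agree outside row and column [q']. *)
rewrite (det_diag1_odd (q := q') hchar) //; last 2 first.
- by rewrite row'Esub col'Esub -mxsubrc trmx_mxsub C1t.
- move=> i iq; rewrite !mxE nonsingular_alternating liftq (negPf iq).
  by rewrite mulr0 addr0.
rewrite -(minors0 gpI) [RHS](det_diag1_odd (q := q') hchar) //; last 2 first.
- exact: mxsub_sym.
- by move=> i iq; rewrite mxE /= /g liftq (negPf iq) nonsingular_alternating.
apply: congr2; last congr (\det _).
  by rewrite !mxE /= /g !liftq !eqxx nonsingular_alternating add0r mulr1.
apply/matrixP => x y; rewrite !mxE /= /g !liftq.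
by rewrite ![lift q' _ == _]eq_sym !(negPf (neq_lift _ _)) mulr0 addr0.
Qed.

End Char2Field.

Section EprEntry.

Variables (F : fieldType) (n : nat) (B : 'M[F]_n).

Lemma epr_termE k : (1 <= k)%N -> (k <= n)%N -> epr_term (epr B) k = epr_entry B k.
Proof. by case: k => // k _ kn; rewrite /epr_term (nth_mktuple _ _ (Ordinal kn)). Qed.

Lemma epr_entryN k : (k <= n)%N ->
  epr_entry B k = eprN <->
  (forall I : {set 'I_n}, #|I| = k -> principal_minor B I = 0).
Proof.
move=> kn; rewrite /epr_entry; case: forallP => [hA|_].
  (* As [k <= n], the first [k] indices form a set of order [k], so [eprA] is not vacuous here. *)
  split=> // h0; pose I := [set i in take k (enum 'I_n)].
  have cI : #|I| = k.
    rewrite cardsE (card_uniqP _) ?take_uniq ?enum_uniq //.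
    by rewrite size_takel // size_enum_ord.
  by have := hA I; rewrite cI h0 // !eqxx.
case: existsP => [[I /andP[/eqP cI nzI]]|hN].
  by split=> // h0; rewrite h0 ?eqxx in nzI.
split=> // _ I cI; apply/eqP/negPn/negP => nzI.
by apply: hN; exists I; rewrite cI eqxx.
Qed.

End EprEntry.

Theorem mainTheorem4 (F : fieldType) (hchar : 2%N \in [pchar F])
    (n : nat) (B : 'M[F]_n) (hB : B \is symmetricmx)
    (l : n.-tuple epr_symbol) (hl : epr B = l)
    (k : nat) (hk1 : (1 <= k)%N) (hkn : (k + 1 <= n)%N)
    (hNAS : (epr_term l k = eprN /\ epr_term l (k + 1)%N = eprA) \/
            (epr_term l k = eprN /\ epr_term l (k + 1)%N = eprS)) :
  odd k /\
  (forall j : nat, (1 <= j)%N -> (j <= n)%N -> odd j -> epr_term l j = eprN).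
Proof.
have Bt : B^T = B.
  (* [symmetricmx] means Hermitian for sign exponent 0 and the identity map. *)
  have /is_hermitianmxP := hB; rewrite expr0 scale1r => {2}->.
  by apply/matrixP => i j; rewrite !mxE.
subst l; rewrite addn1 in hkn hNAS; have kn := ltnW hkn.
rewrite !epr_termE // in hNAS.
have [ek ek1] : epr_entry B k = eprN /\ epr_entry B k.+1 <> eprN.
  by case: hNAS => -[-> ->].
have minors0 (f : 'I_k -> 'I_n) : injective f -> \det (mxsub f f B) = 0.
  move=> fI; rewrite det_mxsub_principal //.
  by move/(epr_entryN B kn): ek => ->; rewrite ?card_imset ?card_ord.
have [I cI nzI] : exists2 I : {set 'I_n}, #|I| = k.+1 & principal_minor B I != 0.
  case: (pickP (fun I : {set 'I_n} => (#|I| == k.+1) && (principal_minor B I != 0))).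
    by move=> I /andP[/eqP cI nzI]; exists I.
  move=> h0; case: ek1; apply/(epr_entryN B hkn) => I cI.
  by apply/eqP/negPn/negP => nzI; have := h0 I; rewrite cI eqxx nzI.
pose f (i : 'I_k.+1) : 'I_n := enum_val (cast_ord (esym cI) i).
have fI : injective f by move=> x y /enum_val_inj/cast_ord_inj.
have fim : f @: 'I_k.+1 = I.
  apply/eqP; rewrite eqEcard card_imset // card_ord cI leqnn andbT.
  by apply/subsetP => _ /imsetP[i _ ->]; apply: enum_valP.
have df : \det (mxsub f f B) != 0 by rewrite det_mxsub_principal // fim.
split; first exact: (nonsingular_order_even hchar Bt minors0 fI df).
have B0 := alternating_of_nonsingular hchar Bt minors0 fI df.
move=> j j1 jn oj; rewrite epr_termE //; apply/(epr_entryN B jn) => J cJ.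
(* The whole diagonal of [B] is now zero, so every principal submatrix of odd order is
   alternating. *)
apply: (det_alternating_odd hchar) => [|i|]; last by rewrite cJ.
  by apply/matrixP => x y; rewrite !mxE -[in LHS]Bt mxE.
by rewrite mxE B0.
Qed.
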